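(* Let $\mathcal F$ be a differential field of characteristic $0$ with pairwise commuting derivations $\Delta=\{\partial_1,\dots,\partial_m\}$, let $D=\mathcal F[\partial_1,\dots,\partial_m]$ be the ring of linear differential operators over $\mathcal F$, and let $\Sigma\subset\mathcal F\{y_1,\dots,y_n\}$ be a system of linear differential polynomials such that $\operatorname{ord}_{y_j}f\le e_j$ for all $f\in\Sigma$ and $1\le j\le n$. Let $M/N$ be the module of differentials of $\Sigma$, and suppose that $a_m(\omega_{[\Sigma]})=0$. Then there exist a differential field extension $\mathcal G$ of $\mathcal F$ and elements $c_2,\dots,c_n\in\mathcal G$ such that, with $\tilde D=\mathcal G\otimes_{\mathcal F}D$ and $\psi=m_1+c_2m_2+\dots+c_nm_n$, the $\tilde D$-module $M/N$ (after extending scalars to $\mathcal G$) is generated by $\psi$, i.e. equals $\tilde D\psi$; and for each $j=1,\dots,n$, the elements $\lambda_j\in\tilde D$ with $\lambda_j\psi=m_j$ can be taken with $$\operatorname{ord}\lambda_j\le 2^m(e_1+\dots+e_n).$$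
   Context: $\mathcal F\{y_1,\dots,y_n\}$ is the ring of differential polynomials: the polynomial ring over $\mathcal F$ in the indeterminates $\theta y_j$, $\theta=\partial_1^{i_1}\cdots\partial_m^{i_m}$, $1\le j\le n$; the order of $\theta$ is $i_1+\dots+i_m$. A differential polynomial is linear if it has degree $1$ in these indeterminates. $D$ consists of skew polynomials $\sum a_\theta\theta$ with $\partial_i a=a\partial_i+\partial_i(a)$; the order of an operator is the maximal order of $\theta$ with $a_\theta\ne0$. Let $M$ be the free $D$-module with basis $m_1,\dots,m_n$ ($m_j$ identified with the differential of $y_j$). A linear $f=\sum_j\sum_\theta a_{\theta,j}\theta y_j+a_0$ gives the element $\sum_j\sigma_j m_j\in M$ with $\sigma_j=\sum_\theta a_{\theta,j}\theta$, and $\operatorname{ord}_{y_j}f=\operatorname{ord}\sigma_j$. $N$ is the $D$-submodule of $M$ generated by the elements corresponding to $f\in\Sigma$; $M/N$ is the module of differentials. Filter $M$ by $M_r=\sum_j D_r m_j$ where $D_r$ is the set of operators of order $\le r$, and $M/N$ by $M_r/(M_r\cap N)$. The Kolchin dimension polynomial $\omega_{[\Sigma]}(s)$ is the numerical polynomial equal to $\dim_{\mathcal F}M_s/(M_s\cap N)$ for large $s$; writing it as $\sum_{i=0}^d a_i\binom{s+i}{i}$ with $a_i\in\mathbb Z$, $a_i(\omega_{[\Sigma]})$ denotes the coefficient $a_i$ (with $a_m=0$ if $d<m$). *)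

(* Defs.v *)
From HB Require Import structures.
From mathcomp Require Import all_boot all_order all_algebra.
From mathcomp Require Import mpoly.
Set Implicit Arguments. Unset Strict Implicit. Unset Printing Implicit Defensive.
Import Order.TTheory GRing.Theory Num.Theory.
Local Open Scope ring_scope.

Definition is_derivation (R : fieldType) (f : R -> R) : Prop :=
  (forall x y, f (x + y) = f x + f y) /\ (forall x y, f (x * y) = f x * y + x * f y).

Definition is_diff_field (R : fieldType) (m : nat) (d : 'I_m -> R -> R) : Prop :=
  (forall i, is_derivation (d i)) /\ (forall i j x, d i (d j x) = d j (d i x)).

Definition is_diff_ext (F G : fieldType) (m : nat) (d : 'I_m -> F -> F)
  (dG : 'I_m -> G -> G) (iota : {rmorphism F -> G}) : Prop :=
  is_diff_field dG /\ (forall i x, iota (d i x) = dG i (iota x)).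

(* The ring D = R[d_0,...,d_{m-1}] of linear differential operators.
   An operator sum_alpha a_alpha d^alpha (coefficients written on the left)
   is represented by the multivariate polynomial sum_alpha a_alpha X^alpha;
   the *additive* and left R-scalar structure is that of {mpoly R[m]},
   but the product is the skew product defined below. *)
Notation diffop R m := {mpoly R[m]}.

(* left multiplication by d_i :  d_i * q = q d_i + d_i(q)  *)
Definition dleft (R : fieldType) (m : nat) (d : 'I_m -> R -> R) (i : 'I_m)
  (q : diffop R m) : diffop R m :=
  q * 'X_i + map_mpoly (d i) q.

Definition dmon (R : fieldType) (m : nat) (d : 'I_m -> R -> R) (alpha : 'X_{1..m})
  (q : diffop R m) : diffop R m :=
  foldr (fun i r => iter (alpha i) (dleft d i) r) q (enum 'I_m).

Definition opmul (R : fieldType) (m : nat) (d : 'I_m -> R -> R)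
  (p q : diffop R m) : diffop R m :=
  \sum_(alpha <- msupp p) p@_alpha *: dmon d alpha q.

(* order of an operator: maximal order |alpha| of d^alpha with nonzero
   coefficient (0 for the zero operator) *)
Definition op_ord (R : fieldType) (m : nat) (p : diffop R m) : nat :=
  (\max_(alpha <- msupp p) mdeg alpha)%N.

(* The free D-module M with basis m_1..m_n : elements are 'I_n -> D
   (v = sum_j v_j m_j).  Linear differential polynomials
   f = sum_j sigma_j y_j + a_0 are represented as pairs (sigma, a_0). *)
Definition ldp (R : fieldType) (m n : nat) := (('I_n -> diffop R m) * R)%type.

Definition is_linear_dp (R : fieldType) (m n : nat) (f : ldp R m n) : Prop :=
  exists j, f.1 j != 0.

Definition in_gen (R : fieldType) (m n : nat) (d : 'I_m -> R -> R)
  (S : ('I_n -> diffop R m) -> Prop) (v : 'I_n -> diffop R m) : Prop :=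
  exists (k : nat) (lam : 'I_k -> diffop R m) (f : 'I_k -> 'I_n -> diffop R m),
    (forall i, S (f i)) /\ (forall j, v j = \sum_(i < k) opmul d (lam i) (f i j)).

Definition sys_elts (R : fieldType) (m n : nat) (Sigma : ldp R m n -> Prop)
  (v : 'I_n -> diffop R m) : Prop :=
  exists f, Sigma f /\ v = f.1.

Definition inN (R : fieldType) (m n : nat) (d : 'I_m -> R -> R)
  (Sigma : ldp R m n -> Prop) (v : 'I_n -> diffop R m) : Prop :=
  in_gen d (sys_elts Sigma) v.

Definition in_Ms (R : fieldType) (m n : nat) (s : nat) (v : 'I_n -> diffop R m) : Prop :=
  forall j, (op_ord (v j) <= s)%N.

Definition indep_mod (R : fieldType) (m n : nat) (d : 'I_m -> R -> R)
  (Sigma : ldp R m n -> Prop) (s k : nat) (v : 'I_k -> 'I_n -> diffop R m) : Prop :=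
  (forall i, in_Ms s (v i)) /\
  (forall a : 'I_k -> R,
      inN d Sigma (fun j => \sum_(i < k) a i *: v i j) -> forall i, a i = 0).

Definition quot_dim (R : fieldType) (m n : nat) (d : 'I_m -> R -> R)
  (Sigma : ldp R m n -> Prop) (s k : nat) : Prop :=
  (exists v : 'I_k -> 'I_n -> diffop R m, indep_mod d Sigma s v) /\
  (forall v : 'I_k.+1 -> 'I_n -> diffop R m, ~ indep_mod d Sigma s v).

(* a_m(omega_[Sigma]) = 0 : the Kolchin polynomial, written as
   sum_{i=0}^{dd} a_i binom(s+i, i), has a_m = 0 (a_m = 0 also when dd < m). *)
Definition kolchin_am_zero (R : fieldType) (m n : nat) (d : 'I_m -> R -> R)
  (Sigma : ldp R m n -> Prop) : Prop :=
  exists (dd : nat) (a : nat -> int),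
    (forall i, (dd < i)%N -> a i = 0) /\ a m = 0 /\
    exists s0 : nat, forall s : nat, (s0 <= s)%N ->
      exists k : nat, quot_dim d Sigma s k /\
        (k%:Z = \sum_(i < dd.+1) a i * ('C(s + i, i))%:Z).

Definition lift_sys (F G : fieldType) (m n : nat) (iota : {rmorphism F -> G})
  (Sigma : ldp F m n -> Prop) (v : 'I_n -> diffop G m) : Prop :=
  exists f, Sigma f /\ v = (fun j => map_mpoly iota (f.1 j)).

(* Main.v *)
(** Vanishing of the top coefficient of the Kolchin polynomial makes every basis
    vector [m_j] torsion modulo [N], so [Sigma] contains [n] elements [f_i] that
    are linearly independent over [D], and they stay so over an extension.  For
    [t = 2^m (e_1 + ... + e_n)] one has
    [sum_j C(t + e_j + m, m) < (n + 1) C(t + m, m)], so by counting coefficients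
    [psi, f_1, ..., f_n] satisfy a relation over operators of order at most [t];
    thus [L psi] lies in [N] for some nonzero [L] of order at most [t].

    Take [c_j = sum_(|g| <= t) u_(j,g) x^g] with constant indeterminates
    [u_(j,g)] and [d_i x_k] the Kronecker delta.  Differentiating the relation
    with respect to [u_(j,g)] shows that [L x^g m_j] is, modulo [N], a multiple
    [lam psi] with [ord lam <= t].  Commuting [L] with the [x_i] lowers its
    order, so [1] lies in the span of the [L x^g] and [m_j] itself is such a
    multiple. *)

Require Import Defs.
From HB Require Import structures.
From mathcomp Require Import all_boot all_order all_algebra.
From mathcomp Require Import ssrcomplements mpoly zify ring.
From Stdlib Require Import Classical.
Set Implicit Arguments.
Unset Strict Implicit.
Unset Printing Implicit Defensive.
Import Order.TTheory GRing.Theory Num.Theory.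
Local Open Scope ring_scope.

(** * Binomial estimates *)

(* The bound [1 + x] with [x = (2^k - 1) e / t] on the ratio of the binomials
   survives [k -> k + 1] because [(1 + x)(1 + e/t) <= 1 + 2x + e/t]. *)
Lemma bin_shift_le (t e k : nat) : (e <= t)%N ->
  (t * 'C(t + e + k, k) <= (t + (2 ^ k - 1) * e) * 'C(t + k, k))%N.
Proof.
move=> le_et; elim: k => [|k IHk]; first by rewrite !bin0; lia.
have diag N : ((N + k.+1) * 'C(N + k, k) = k.+1 * 'C(N + k.+1, k.+1))%N.
  by rewrite -mul_bin_diag addnS.
have [p] : exists p, (2 ^ k = p.+1)%N by exists (2 ^ k).-1; rewrite prednK ?expn_gt0.
rewrite expnS => Ep; rewrite Ep subn1 /= in IHk *.
have := diag (t + e)%N; have := diag t.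
set x := 'C(t + k, k) in IHk *; set x' := 'C(t + k.+1, _).
set y := 'C(t + e + k, k) in IHk *; set y' := 'C(t + e + k.+1, _) => Hx Hy.
rewrite -(leq_pmul2l (ltn0Sn k)) [X in (X <= _)%N]mulnCA -Hy.
rewrite [X in (_ <= X)%N]mulnCA -Hx.
have [->|t_gt0] := posnP t; first by rewrite mul0n.
rewrite -(leq_pmul2l t_gt0).
apply: (@leq_trans (t * (t + e + k.+1) * ((t + p * e) * x)))%N.
  have -> : (t * (t * ((t + e + k.+1) * y)) = t * (t + e + k.+1) * (t * y))%N.
    by ring.
  by rewrite leq_mul2l IHk orbT.
suff H : ((t + e + k.+1) * (t + p * e) <=
          (t + (2 * p.+1 - 1) * e) * (t + k.+1))%N.
  by move: (leq_mul (leq_mul (leqnn t) H) (leqnn x)); rewrite -!mulnA.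
have -> : (2 * p.+1 - 1 = p + p.+1)%N by lia.
have : (p * e * e <= p * e * t)%N by rewrite leq_mul2l le_et orbT.
nia.
Qed.

(** Summing the ratio bound over [j] leaves the factor [n * t + (2 ^ m - 1) * E], where [E] is the
    sum of the [e j]. For [E > 0] this is less than [n.+1 * t], because [2 ^ m * E <= t]. *)
Lemma sum_bin_shift_lt (n m t : nat) (e : 'I_n -> nat) :
  (2 ^ m * \sum_(j < n) e j <= t)%N ->
  (\sum_(j < n) 'C(t + e j + m, m) < n.+1 * 'C(t + m, m))%N.
Proof.
move=> le_t; have bin0 : (0 < 'C(t + m, m))%N by rewrite bin_gt0 leq_addl.
have le_e j : (e j <= \sum_(j < n) e j)%N by rewrite (bigD1 j) //= leq_addr.
(* If all [e j] vanish, [t] may be 0 and the ratio bound, which carries a factor [t], gives nothing;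
   all binomials are then equal. *)
have [sum0|sum_gt0] := posnP (\sum_(j < n) e j)%N.
  rewrite (eq_bigr (fun=> 'C(t + m, m))) ?sum_nat_const ?card_ord.
    by rewrite mulSn -[X in (X < _)%N]add0n ltn_add2r.
  by move=> j _; move: (le_e j); rewrite sum0 leqn0 => /eqP ->; rewrite addn0.
have pow_gt0 : (0 < 2 ^ m)%N by rewrite expn_gt0.
have le_et j : (e j <= t)%N by have := le_e j; nia.
have t_gt0 : (0 < t)%N by nia.
rewrite -(ltn_pmul2l t_gt0) big_distrr /=.
apply: (@leq_ltn_trans (\sum_(j < n) (t + (2 ^ m - 1) * e j) * 'C(t + m, m))%N).
  by apply: leq_sum => j _; apply: bin_shift_le.
rewrite -big_distrl /= big_split /= -big_distrr /= sum_nat_const card_ord.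
rewrite mulnA ltn_pmul2r // mulnS mulnC addnC ltn_add2r.
by apply: leq_trans le_t; rewrite ltn_pmul2r //; lia.
Qed.

(** * Growth of integer combinations of binomials *)

Lemma bin_unbounded (q A s0 : nat) :
  exists2 s, (s0 <= s)%N & (A * 'C(s + q, q) < 'C(s + q.+1, q.+1))%N.
Proof.
(* Since [q.+1 * 'C(s + q.+1, q.+1) = (s + q.+1) * 'C(s + q, q)], any [s >= A * q.+1] works. *)
exists (s0 + A * q.+1)%N; first exact: leq_addr.
set s := (s0 + _)%N; rewrite -(ltn_pmul2l (ltn0Sn q)).
have := mul_bin_diag (s + q.+1) q; rewrite addnS /= => <-.
have : (0 < 'C(s + q, q))%N by rewrite bin_gt0 leq_addl.
by rewrite /s; nia.
Qed.

Lemma bin_diag_le (s i q : nat) : (i <= q)%N -> ('C(s + i, i) <= 'C(s + q, q))%N.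
Proof.
elim: q => [|q IHq]; first by rewrite leqn0 => /eqP ->.
rewrite leq_eqVlt => /predU1P[-> //|/IHq/leq_trans]; apply.
by rewrite addnS binS leq_addl.
Qed.

Lemma bin_comb_le (a : nat -> int) (p q s : nat) : (p <= q.+1)%N ->
  `|\sum_(i < p) a i * 'C(s + i, i)%:Z| <=
  (\sum_(i < p) `|a i|%N)%N%:Z * 'C(s + q, q)%:Z.
Proof.
move=> le_pq; apply: le_trans (ler_norm_sum _ _ _) _.
rewrite (big_morph Posz PoszD (erefl _)) mulr_suml.
apply: ler_sum => i _; rewrite normrM; apply: ler_pM => //.
by rewrite ger0_norm // lez_nat bin_diag_le // -ltnS (leq_trans (ltn_ord i)).
Qed.

(** A combination whose last nonzero coefficient has index [q] grows like [s^q] in absolute value.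
    As [a m = 0], either [q < m] and the lower bound fails for large [s], or [q > m] and the upper
    bound fails. *)
Lemma bin_comb_neq (a : nat -> int) (dd m n s0 : nat) : a m = 0 ->
  ~ (forall s, (s0 <= s)%N ->
       'C(s + m, m)%:Z <= \sum_(i < dd) a i * 'C(s + i, i)%:Z
         <= n%:Z * 'C(s + m, m)%:Z).
Proof.
move=> am0; elim: dd => [|q IHq] H.
  have /andP[+ _] := H s0 (leqnn _); rewrite big_ord0 lez_nat leqn0.
  by rewrite -leqn0 leqNgt bin_gt0 leq_addl.
have [aq0|aq_neq0] := eqVneq (a q) 0.
  apply: IHq => s /H; rewrite big_ord_recr /= aq0 mul0r addr0; apply.
have [lt_qm|lt_mq|eq_qm] := ltngtP q m; last by rewrite eq_qm am0 eqxx in aq_neq0.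
  case: m lt_qm {am0 IHq} H => // m lt_qm H.
  have [s /H/andP[lo _]] := bin_unbounded m (\sum_(i < q.+1) `|a i|)%N s0.
  rewrite ltnNge -lez_nat PoszM => /negP; apply; apply: le_trans lo _.
  by apply: le_trans (ler_norm _) _; apply: bin_comb_le.
case: q lt_mq aq_neq0 {IHq} H => // q le_mq aq_neq0 H.
have [s /H/andP[lo up]] := bin_unbounded q (\sum_(i < q.+1) `|a i| + n)%N s0.
rewrite ltnNge -lez_nat PoszM PoszD mulrDl => /negP; apply.
set b := 'C(s + q.+1, q.+1)%:Z; set c := 'C(s + q, q)%:Z in up *.
have up' : `|\sum_(i < q.+2) a i * 'C(s + i, i)%:Z| <= n%:Z * c.
  rewrite ger0_norm; last by apply: le_trans lo.
  by apply: le_trans up _; rewrite ler_wpM2l // lez_nat bin_diag_le.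
(* A nonzero integer has absolute value at least 1, so the top term is at least [b]; yet it is the
   total minus the lower terms, both bounded by multiples of [c]. *)
have : b <= `|a q.+1 * b|.
  by rewrite normrM (ger0_norm (isT : 0 <= b)) ler_peMl // -gtz0_ge1 normr_gt0.
move/le_trans; apply; rewrite -[a _ * b](addrK (\sum_(i < q.+1) a i * 'C(s + i, i)%:Z)).
apply: le_trans (ler_normB _ _) _; rewrite addrC lerD ?bin_comb_le //.
by move: up'; rewrite big_ord_recr /= addrC.
Qed.

(** * Linear systems *)

Lemma card_bmultinom (m t : nat) : #|{: 'X_{1..m < t.+1}}| = 'C(t + m, m).
Proof.
rewrite addnC -card_partial_ord_partitions -cardsT.
pose f (a : 'X_{1..m < t.+1}) : m.-tuple 'I_t.+1 := [tuple inord (a i) | i < m].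
have le_at (a : 'X_{1..m < t.+1}) i : (a i < t.+1)%N.
  by apply: leq_ltn_trans (bmdeg a); rewrite mdegE (bigD1 i) //= leq_addr.
have f_inj : injective f.
  move=> a b /(congr1 (fun u => nat_of_ord (tnth u _))) eq_ab.
  apply: val_inj; apply/mnmP => i.
  by have := eq_ab i; rewrite !tnth_mktuple !inordK.
rewrite -(card_imset _ f_inj); apply: eq_card => u; rewrite !inE.
apply/imsetP/idP => [[a _ ->]|le_ut].
  rewrite big_tuple (eq_bigr (fun i => a i)); first by rewrite -mdegE -ltnS bmdeg.
  by move=> i _; rewrite tnth_mktuple inordK.
have u_lt : (mdeg [multinom (tnth u i : nat) | i < m] < t.+1)%N.
  rewrite ltnS mdegE (eq_bigr (fun i => tnth u i : nat)); last first.
    by move=> i _; rewrite mnmE.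
  by move: le_ut; rewrite big_tuple.
exists (BMultinom u_lt) => //; apply: eq_from_tnth => i.
by rewrite tnth_mktuple /= mnmE; apply: val_inj; rewrite /= inordK.
Qed.

(** Kernel matrices have a rank, which yields relations by counting, and they commute with field
    morphisms, which lets relations descend. *)
Lemma relation_kermx (K : fieldType) (I J : finType) (A : I -> J -> K) :
  (exists2 x : I -> K, (exists i, x i != 0) & forall j, \sum_i x i * A i j = 0) <->
  kermx (\matrix_(i < #|I|, j < #|J|) A (enum_val i) (enum_val j)) != 0.
Proof.
split=> [[x [i xi_neq0] xA0]|].
  apply/rowV0Pn; exists (\row_k x (enum_val k)); last first.
    by apply/rV0Pn; exists (enum_rank i); rewrite mxE enum_rankK.
  apply/sub_kermxP/matrixP => r j; rewrite !mxE -[RHS](xA0 (enum_val j)).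
  rewrite [RHS](reindex_onto enum_val enum_rank) => [|i' _]; last first.
    by rewrite enum_rankK.
  by apply: eq_big => [i'|i' _]; rewrite ?enum_valK ?eqxx // !mxE.
case/rowV0Pn => v /sub_kermxP vB0 /rV0Pn[k vk_neq0].
exists (fun i => v 0 (enum_rank i)); first by exists (enum_val k); rewrite enum_valK.
move=> j; move/matrixP/(_ 0 (enum_rank j)): vB0; rewrite !mxE => vB0; rewrite -[RHS]vB0.
rewrite (reindex_onto enum_val enum_rank) => [|i' _]; last by rewrite enum_rankK.
apply: eq_big => [i'|i' _]; first by rewrite enum_valK eqxx.
by rewrite mxE enum_valK enum_rankK.
Qed.

Lemma nontrivial_relation (K : fieldType) (I J : finType) (A : I -> J -> K) :
  (#|J| < #|I|)%N ->
  exists2 x : I -> K, (exists i, x i != 0) & forall j, \sum_i x i * A i j = 0.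
Proof.
move=> ltJI; apply/relation_kermx; set B := \matrix_(i, j) _.
rewrite -mxrank_eq0 mxrank_ker subn_eq0 -ltnNge.
exact: leq_ltn_trans (rank_leq_col B) ltJI.
Qed.

Lemma relation_descent (K L : fieldType) (f : {rmorphism K -> L})
    (I J : finType) (A : I -> J -> K) :
  (exists2 x : I -> L, (exists i, x i != 0)
    & forall j, \sum_i x i * f (A i j) = 0) ->
  exists2 y : I -> K, (exists i, y i != 0) & forall j, \sum_i y i * A i j = 0.
Proof.
move/relation_kermx => kerA; apply/relation_kermx.
rewrite -(map_mx_eq0 f) map_kermx.
rewrite (_ : map_mx f _ = \matrix_(i, j) f (A (enum_val i) (enum_val j))) //.
by apply/matrixP => i j; rewrite !mxE.
Qed.

(** * The ring of differential operators *)

Lemma mnm_neq0P (m : nat) (a : 'X_{1..m}) : a != 0%MM -> exists i, a i != 0%N.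
Proof.
move=> a_neq0; apply/existsP; rewrite -negb_forall.
apply: contra_neqN a_neq0 => /forallP a0.
by apply/mnmP => i; rewrite mnm0E; apply/eqP/a0.
Qed.

Lemma mnm_ind_add (m : nat) (P : 'X_{1..m} -> Prop) :
  P 0%MM -> (forall a i, P a -> P (a + U_(i))%MM) -> forall a, P a.
Proof.
move=> P0 PS a; have [k] := ubnP (mdeg a); elim: k a => // k IHk a lt_ak.
have [->//|a_neq0] := eqVneq a 0%MM.
have [i ai_neq0] := mnm_neq0P a_neq0.
have le_ia : (U_(i) <= a)%MM by rewrite lep1mP.
rewrite -(submK le_ia); apply/PS/IHk.
by move: lt_ak; rewrite -{1}(submK le_ia) mdegD mdeg1 addn1.
Qed.

Lemma msize_leP (m : nat) (R : nzRingType) (k : nat) (p : {mpoly R[m]}) :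
  (forall a, (k <= mdeg a)%N -> p@_a = 0) <-> (msize p <= k)%N.
Proof.
split=> [p0 | le_pk a le_ka]; last first.
  by apply/memN_msupp_eq0/msize_mdeg_ge/(leq_trans le_pk).
rewrite msizeE; apply/bigmax_leqP_seq => a a_p _; rewrite ltnNge.
by apply: contraL a_p => /p0 /eqP; rewrite mcoeff_eq0.
Qed.

Lemma msizeMX (R : fieldType) (m : nat) (a : 'X_{1..m}) (p : {mpoly R[m]}) :
  (msize (p * 'X_[a]) <= mdeg a + msize p)%N.
Proof.
have [->|p_neq0] := eqVneq p 0; first by rewrite mul0r mmeasure0.
by rewrite msizeM // -?msize_poly_eq0 msizeX // addnS addnC.
Qed.

Lemma op_ord_msize (R : fieldType) (m t : nat) (p : diffop R m) :
  (op_ord p <= t)%N = (msize p <= t.+1)%N.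
Proof.
apply/bigmax_leqP_seq/idP => [H | le_pt a a_p _].
  by rewrite msizeE; apply/bigmax_leqP_seq => a a_p _; rewrite ltnS H.
by rewrite -ltnS; apply: leq_trans le_pt; apply: msize_mdeg_lt.
Qed.

(** Stated for rings, unlike [is_derivation], so as to cover coefficientwise maps and partial
    derivatives on polynomial rings. *)
Definition derivation (R : nzRingType) (f : R -> R) : Prop :=
  (forall x y, f (x + y) = f x + f y) /\ (forall x y, f (x * y) = f x * y + x * f y).

(** * Derivations and their coefficientwise action on polynomials *)

Section Derivation.
Variables (R : nzRingType) (f : R -> R) (hf : derivation f).

Lemma der0 : f 0 = 0.
Proof. by apply: (addrI (f 0)); rewrite addr0 -hf.1 addr0. Qed.

Lemma derN x : f (- x) = - f x.
Proof. by apply: (addrI (f x)); rewrite -hf.1 !subrr der0. Qed.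

Lemma der_zmod : zmod_morphism f.
Proof. by move=> x y; rewrite hf.1 derN. Qed.

Lemma der1 : f 1 = 0.
Proof. by apply: (addrI (f 1)); rewrite addr0 -{3}[1]mulr1 hf.2 mulr1 mul1r. Qed.

Lemma der_sum (I : Type) (r : seq I) (P : pred I) (F : I -> R) :
  f (\sum_(i <- r | P i) F i) = \sum_(i <- r | P i) f (F i).
Proof. exact: (big_morph f hf.1 der0). Qed.

Variable m : nat.
Implicit Types p q : {mpoly R[m]}.
Local Notation mapf := (@map_mpoly m R R f).

Let fa : {additive R -> R} := HB.pack f (GRing.isZmodMorphism.Build R R f der_zmod).

Lemma mcoeff_map_der a p : (mapf p)@_a = f p@_a.
Proof. exact: (mcoeff_map_mpoly fa). Qed.

Lemma map_derD p q : mapf (p + q) = mapf p + mapf q.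
Proof. by apply/mpolyP => a; rewrite !(mcoeff_map_der, mcoeffD) hf.1. Qed.

Lemma map_der_sum (I : Type) (r : seq I) (P : pred I) (F : I -> {mpoly R[m]}) :
  mapf (\sum_(i <- r | P i) F i) = \sum_(i <- r | P i) mapf (F i).
Proof.
apply: (big_morph mapf map_derD); apply/mpolyP => a.
by rewrite mcoeff_map_der !mcoeff0 der0.
Qed.

Lemma map_derZ c p : mapf (c *: p) = c *: mapf p + f c *: p.
Proof.
by apply/mpolyP => a; rewrite !(mcoeff_map_der, mcoeffD, mcoeffZ) hf.2 addrC.
Qed.

Lemma map_derC c : mapf c%:MP_[m] = (f c)%:MP.
Proof.
apply/mpolyP => a; rewrite mcoeff_map_der !mcoeffC.
by case: eqP => _; rewrite ?mulr1 // !mulr0 der0.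
Qed.

Lemma map_derX a : mapf 'X_[R, a] = 0.
Proof.
apply/mpolyP => b; rewrite mcoeff_map_der mcoeffX mcoeff0.
by case: eqP => _; rewrite ?der1 ?der0.
Qed.

Lemma map_derM : derivation mapf.
Proof.
split=> [|p q]; first exact: map_derD.
apply/mpolyP => a; rewrite mcoeff_map_der mcoeffD !mcoeffM der_sum -big_split.
by apply: eq_bigr => b _; rewrite !mcoeff_map_der hf.2.
Qed.

Lemma msize_map_der p : (msize (mapf p) <= msize p)%N.
Proof.
apply/msize_leP => a /(msize_leP (msize p) p).2 p0.
by rewrite mcoeff_map_der p0 ?der0.
Qed.

Lemma map_der_deriv i p : mapf p^`M(i) = (mapf p)^`M(i).
Proof.
apply/mpolyP => a; rewrite !(mcoeff_map_der, mcoeff_deriv).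
by elim: (a i) => // k IHk; rewrite [in LHS]mulrS [in RHS]mulrS hf.1 IHk.
Qed.

End Derivation.

(** * The skew product: associativity, orders, absence of zero divisors *)

Section Operators.
Variables (R : fieldType) (m : nat) (d : 'I_m -> R -> R) (hd : is_diff_field d).
Implicit Types (p q r : diffop R m) (a b : 'X_{1..m}) (i j : 'I_m).

Let dP i : derivation (d i) := hd.1 i.

Lemma dleftD i q r : dleft d i (q + r) = dleft d i q + dleft d i r.
Proof. by rewrite /dleft mulrDl (map_derD (dP i)) addrACA. Qed.

Lemma dleft0 i : dleft d i 0 = 0.
Proof. by apply: (addrI (dleft d i 0)); rewrite -dleftD !addr0. Qed.

Lemma dleftZ i c q : dleft d i (c *: q) = c *: dleft d i q + d i c *: q.
Proof. by rewrite /dleft (map_derZ (dP i)) -scalerAl scalerDr addrA. Qed.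

Lemma dleftC i j q : dleft d i (dleft d j q) = dleft d j (dleft d i q).
Proof.
have comm : map_mpoly (d i) (map_mpoly (d j) q) = map_mpoly (d j) (map_mpoly (d i) q).
  apply/mpolyP => a.
  transitivity (d i (d j q@_a)).
    by rewrite -(mcoeff_map_der (dP j)); apply: (mcoeff_map_der (dP i)).
  rewrite hd.2 -(mcoeff_map_der (dP i)).
  by symmetry; apply: (mcoeff_map_der (dP j)).
have mapMX k l : map_mpoly (d k) (q * 'X_l) = map_mpoly (d k) q * 'X_l.
  by rewrite (map_derM (dP k) m).2 (map_derX (dP k)) mulr0 addr0.
rewrite /dleft !(map_derD (dP _)) !mapMX comm.
set q2 := map_mpoly _ (map_mpoly _ q).
set qi := map_mpoly (d i) q; set qj := map_mpoly (d j) q; set x := 'X_i; set y := 'X_j.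
by rewrite !mulrDl [q * y * x]mulrAC addrACA.
Qed.

Lemma dleftX i a : dleft d i 'X_[a] = 'X_[a + U_(i)].
Proof. by rewrite /dleft (map_derX (dP i)) addr0 mpolyXD. Qed.

Lemma dleftE i q : dleft d i q = q * 'X_i + map_mpoly (d i) q.
Proof. by []. Qed.

Local Opaque dleft.

Lemma dmon0 q : dmon d 0 q = q.
Proof. by rewrite /dmon; elim: (enum _) => //= i s ->; rewrite mnm0E. Qed.

(** [dmon] applies the derivations in the order of [enum]; one more factor can be moved to the left
    end because the [dleft d j] commute. *)
Lemma dmonS a i q : dmon d (a + U_(i)) q = dleft d i (dmon d a q).
Proof.
rewrite /dmon; have := mem_enum 'I_m i; have := enum_uniq 'I_m.
rewrite inE; elim: (enum _) => //= j s IHs /andP[j_s uniq_s].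
rewrite inE mnmDE mnm1E; have [-> _|neq_ij] := eqVneq i j.
  rewrite addn1 iterS; congr (dleft d _ (iter _ _ _)).
  elim: s j_s {IHs uniq_s} => //= k s IHs; rewrite inE negb_or => /andP[neq_jk].
  by move/IHs ->; rewrite mnmDE mnm1E (negPf neq_jk) addn0.
move=> i_s; rewrite addn0 (IHs uniq_s i_s).
by elim: (a j) => [//|k IHk]; rewrite !iterS IHk dleftC.
Qed.

Lemma dmonD a q r : dmon d a (q + r) = dmon d a q + dmon d a r.
Proof.
by elim/mnm_ind_add: a => [|a i IHa]; rewrite ?dmon0 // !dmonS IHa dleftD.
Qed.

Lemma dmon_zero a : dmon d a 0 = 0.
Proof. by apply: (addrI (dmon d a 0)); rewrite -dmonD !addr0. Qed.

Lemma dmonX a b : dmon d a 'X_[b] = 'X_[b + a].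
Proof.
elim/mnm_ind_add: a => [|a i IHa]; first by rewrite dmon0 addm0.
by rewrite dmonS IHa dleftX addmA.
Qed.

(** Summing over all exponents of degree below a common [k], in place of the support of [p], makes
    additivity in [p] a termwise fact. *)
Lemma opmulE k p q : (msize p <= k)%N ->
  opmul d p q = \sum_(a : 'X_{1..m < k}) p@_a *: dmon d a q.
Proof.
move=> le_pk; pose I : subFinType _ := 'X_{1..m < k}.
rewrite /opmul (big_mksub I) /=; first last.
  by move=> x /msize_mdeg_lt/leq_trans/(_ le_pk).
  by rewrite msupp_uniq.
by rewrite big_rmcond //= => a /memN_msupp_eq0 ->; rewrite scale0r.
Qed.

Lemma opmulDl p q r : opmul d (p + q) r = opmul d p r + opmul d q r.
Proof.
pose k := (msize p + msize q)%N.
have le_pq : (msize (p + q) <= k)%N.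
  by apply: leq_trans (msizeD_le p q) _; rewrite geq_max leq_addr leq_addl.
rewrite !(@opmulE k) ?leq_addr ?leq_addl // -big_split.
by apply: eq_bigr => a _; rewrite mcoeffD scalerDl.
Qed.

Lemma opmulZl c p q : opmul d (c *: p) q = c *: opmul d p q.
Proof.
rewrite !(@opmulE (msize p)) ?msizeZ_le // scaler_sumr.
by apply: eq_bigr => a _; rewrite mcoeffZ scalerA.
Qed.

Lemma opmul0l q : opmul d 0 q = 0.
Proof. by rewrite /opmul msupp0 big_nil. Qed.

Lemma opmulNl p q : opmul d (- p) q = - opmul d p q.
Proof. by rewrite -scaleN1r opmulZl scaleN1r. Qed.

Lemma opmul_suml (I : Type) (s : seq I) (P : pred I) (F : I -> diffop R m) q :
  opmul d (\sum_(i <- s | P i) F i) q = \sum_(i <- s | P i) opmul d (F i) q.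
Proof.
exact: (big_morph (fun p => opmul d p q) (fun p r => opmulDl p r q) (opmul0l q)).
Qed.

Lemma opmulDr p q r : opmul d p (q + r) = opmul d p q + opmul d p r.
Proof.
rewrite /opmul -big_split.
by apply: eq_bigr => a _; rewrite dmonD scalerDr.
Qed.

Lemma opmul0r p : opmul d p 0 = 0.
Proof. by rewrite /opmul big1 // => a _; rewrite dmon_zero scaler0. Qed.

Lemma opmulNr p q : opmul d p (- q) = - opmul d p q.
Proof. by apply: (addrI (opmul d p q)); rewrite -opmulDr !subrr opmul0r. Qed.

Lemma opmul_sumr (I : Type) (s : seq I) (P : pred I) (F : I -> diffop R m) p :
  opmul d p (\sum_(i <- s | P i) F i) = \sum_(i <- s | P i) opmul d p (F i).
Proof. exact: (big_morph (opmul d p) (opmulDr p) (opmul0r p)). Qed.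

Lemma opmulX a q : opmul d 'X_[a] q = dmon d a q.
Proof. by rewrite /opmul msuppX big_seq1 mcoeffX eqxx scale1r. Qed.

Lemma opmulC c q : opmul d c%:MP q = c *: q.
Proof. by rewrite -alg_mpolyC opmulZl -mpolyX0 opmulX dmon0. Qed.

Lemma opmul1l q : opmul d 1 q = q.
Proof. by rewrite -mpolyC1 opmulC scale1r. Qed.

Lemma opmul1r p : opmul d p 1 = p.
Proof.
rewrite [RHS]mpolyE /opmul; apply: eq_bigr => a _.
by rewrite -mpolyX0 dmonX add0m.
Qed.

Lemma dleft_opmul i q r : dleft d i (opmul d q r) = opmul d (dleft d i q) r.
Proof.
elim/mpolyind: q => [|c b q _ _ IHq]; first by rewrite dleft0 opmul0l dleft0.
rewrite (opmulDl (c *: _) q) !dleftD IHq (opmulDl (dleft d i (c *: _))).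
congr (_ + _); rewrite opmulZl opmulX !dleftZ dleftX.
by rewrite (opmulDl (c *: _)) !opmulZl !opmulX dmonS.
Qed.

Lemma opmulA p q r : opmul d p (opmul d q r) = opmul d (opmul d p q) r.
Proof.
elim/mpolyind: p => [|c a p _ _ IHp]; first by rewrite !opmul0l.
rewrite !opmulDl IHp !opmulZl !opmulX; congr (_ *: _ + _).
elim/mnm_ind_add: a => [|a i IHa]; first by rewrite !dmon0.
by rewrite !dmonS IHa dleft_opmul.
Qed.

Lemma msize_dleft i q : (msize (dleft d i q) <= (msize q).+1)%N.
Proof.
rewrite dleftE; apply: leq_trans (msizeD_le _ _) _; rewrite geq_max.
rewrite (leq_trans (msize_map_der (dP i) q)) // andbT.
by apply: leq_trans (msizeMX _ _) _; rewrite mdeg1.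
Qed.

Lemma msize_dmon a q : (msize (dmon d a q) <= mdeg a + msize q)%N.
Proof.
elim/mnm_ind_add: a => [|a i IHa]; first by rewrite dmon0 mdeg0.
by rewrite dmonS mdegD mdeg1 addn1 (leq_trans (msize_dleft _ _)).
Qed.

(* The skew product and the commutative product have the same symbol. *)
Lemma msize_dmon_subM a q : q != 0 ->
  (msize (dmon d a q - q * 'X_[a]) < mdeg a + msize q)%N.
Proof.
move=> q_neq0; elim/mnm_ind_add: a => [|a i IHa].
  by rewrite dmon0 mpolyX0 mulr1 subrr mmeasure0 mdeg0 lt0n msize_poly_eq0.
rewrite dmonS dleftE mpolyXD mulrA addrAC -mulrBl mdegD mdeg1 addn1.
rewrite addSn ltnS (leq_trans (msizeD_le _ _)) // geq_max.
rewrite (leq_trans (msize_map_der (dP i) _) (msize_dmon _ _)) andbT.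
by apply: leq_trans (msizeMX _ _) _; rewrite mdeg1.
Qed.

(** If the skew product of nonzero operators vanished, the commutative product [q * p], which has
    the same symbol, would have too small a degree. *)
Lemma opmul_eq0 p q : opmul d p q = 0 -> p = 0 \/ q = 0.
Proof.
have [->|p_neq0] := eqVneq p 0; first by left.
have [->|q_neq0] := eqVneq q 0; first by right.
move=> pq0; have : (msize (q * p) < (msize p + msize q).-1)%N.
  rewrite -msizeN -[- _]add0r -pq0.
  have -> : q * p = \sum_(a <- msupp p) p@_a *: (q * 'X_[a]).
    rewrite {1}[p]mpolyE mulr_sumr; apply: eq_bigr => a _.
    by rewrite -scalerAr.
  rewrite -sumrB (leq_ltn_trans (msize_sum _ _ _)) //.
  apply: (@leq_ltn_trans ((msize p + msize q).-2)).
    apply/bigmax_leqP_seq => a /msize_mdeg_lt lt_ap _; rewrite -scalerBr.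
    rewrite (leq_trans (msizeZ_le _ _)) //.
    have := msize_dmon_subM a q_neq0; move: lt_ap.
    move: (msize p) (msize q) (msize (_ - _)) (mdeg a) => x y z w. lia.
  by move: (mpolySpred mdeg p_neq0) (mpolySpred mdeg q_neq0) => -> ->; rewrite addnS.
by rewrite msizeM // addnC ltnn.
Qed.

End Operators.

(** * Rank and torsion *)

Section Rank.
Variables (R : fieldType) (m : nat) (d : 'I_m -> R -> R) (hd : is_diff_field d).
Implicit Types (p q : diffop R m).

Definition op_of (k : nat) (x : 'X_{1..m < k} -> R) : diffop R m :=
  \sum_(a : 'X_{1..m < k}) x a *: 'X_[a].

Lemma mcoeff_op_of k (x : 'X_{1..m < k} -> R) (a : 'X_{1..m < k}) :
  (op_of x)@_a = x a.
Proof.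
rewrite raddf_sum (bigD1 a) //= mcoeffZ mcoeffX eqxx mulr1 big1 ?addr0 // => b.
by rewrite bmeqP mcoeffZ mcoeffX => /negPf ->; rewrite mulr0.
Qed.

Lemma msize_op_of k (x : 'X_{1..m < k} -> R) : (msize (op_of x) <= k)%N.
Proof.
rewrite (leq_trans (msize_sum _ _ _)) //; apply/bigmax_leqP_seq => a _ _.
by rewrite (leq_trans (msizeZ_le _ _)) // msizeX bmdeg.
Qed.

Lemma op_of_coeff k p : (msize p <= k)%N ->
  op_of (fun a : 'X_{1..m < k} => p@_a) = p.
Proof. by move=> le_pk; rewrite [RHS](mpolywE le_pk). Qed.

Lemma opmul_op_of k (x : 'X_{1..m < k} -> R) q :
  opmul d (op_of x) q = \sum_(a : 'X_{1..m < k}) x a *: dmon d a q.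
Proof.
rewrite /op_of opmul_suml; apply: eq_bigr => a _.
by rewrite opmulZl opmulX.
Qed.

Variable n : nat.
Implicit Types u v : 'I_n -> diffop R m.

(* Operators of order at most [t] applied to vectors of order at most [e j] in
   the [j]-th component: the unknowns are the coefficients of the operators,
   the equations the coefficients of the result. *)
Definition rel_coeff (k t : nat) (e : 'I_n -> nat) (f : 'I_k -> 'I_n -> diffop R m)
    (ia : 'I_k * 'X_{1..m < t.+1}) (jb : {j : 'I_n & 'X_{1..m < (t + e j).+1}}) : R :=
  (dmon d ia.2 (f ia.1 (tag jb)))@_(tagged jb).

Lemma rel_coeffP (k t : nat) (e : 'I_n -> nat) (f : 'I_k -> 'I_n -> diffop R m)
    (x : 'I_k * 'X_{1..m < t.+1} -> R) :
  (forall i j, (msize (f i j) <= (e j).+1)%N) ->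
  (forall jb, \sum_ia x ia * rel_coeff (e := e) f ia jb = 0) <->
  (forall j, \sum_i opmul d (op_of (fun a => x (i, a))) (f i j) = 0).
Proof.
move=> le_fe.
have coefE j b : (\sum_i opmul d (op_of (fun a => x (i, a))) (f i j))@_b =
    \sum_ia x ia * (dmon d ia.2 (f ia.1 j))@_b.
  rewrite raddf_sum.
  transitivity (\sum_i \sum_(a : 'X_{1..m < t.+1})
      x (i, a) * (dmon d a (f i j))@_b); last first.
    by rewrite pair_bigA; apply: eq_bigr => -[].
  apply: eq_bigr => i _; rewrite opmul_op_of raddf_sum; apply: eq_bigr => a _.
  by rewrite /= mcoeffZ.
split=> [x0 j | x0 [j b]]; last by rewrite /rel_coeff /= -coefE x0 mcoeff0.
apply/mpolyP => b; rewrite mcoeff0; have [lt_b|le_b] := ltnP (mdeg b) (t + e j).+1.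
  rewrite coefE.
  by rewrite -[RHS](x0 (Tagged (fun j => 'X_{1..m < (t + e j).+1}) (BMultinom lt_b))).
rewrite coefE big1 // => -[i a] _ /=.
apply/eqP; rewrite mulf_eq0; apply/orP; right; apply/eqP.
apply: (msize_leP (t + e j).+1 _).2 le_b; apply: leq_trans (msize_dmon hd _ _) _.
by rewrite -addnS leq_add ?le_fe // -ltnS bmdeg.
Qed.

(** The operators have [k * 'C(t + m, m)] unknown coefficients, and each possible coefficient of the
    result gives one equation; the second hypothesis says that there are more unknowns. *)
Lemma op_relation (k t : nat) (e : 'I_n -> nat) (f : 'I_k -> 'I_n -> diffop R m) :
  (forall i j, (msize (f i j) <= (e j).+1)%N) ->
  (\sum_j 'C(t + e j + m, m) < k * 'C(t + m, m))%N ->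
  exists lam : 'I_k -> diffop R m, [/\ exists i, lam i != 0,
    forall i, (msize (lam i) <= t.+1)%N &
    forall j, \sum_i opmul d (lam i) (f i j) = 0].
Proof.
move=> le_fe lt_card.
have [|x [[i a] xia_neq0] /(rel_coeffP x le_fe) x0] :=
    nontrivial_relation (rel_coeff (t := t) (e := e) f).
  rewrite card_prod card_ord card_bmultinom; apply: leq_ltn_trans lt_card.
  rewrite card_tagged sumnE big_map big_enum /=.
  by apply: leq_sum => j _; rewrite card_bmultinom.
exists (fun i => op_of (fun a => x (i, a))).
split=> //; last by move=> i'; apply: msize_op_of.
exists i; apply: contra_neq xia_neq0 => /(congr1 (mcoeff a)).
by rewrite mcoeff_op_of mcoeff0.
Qed.

Definition dindep (k : nat) (f : 'I_k -> 'I_n -> diffop R m) : Prop :=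
  forall lam : 'I_k -> diffop R m,
    (forall j, \sum_i opmul d (lam i) (f i j) = 0) -> forall i, lam i = 0.

Lemma not_dindepP (k : nat) (f : 'I_k -> 'I_n -> diffop R m) : ~ dindep f ->
  exists2 lam : 'I_k -> diffop R m, (exists i, lam i != 0)
    & forall j, \sum_i opmul d (lam i) (f i j) = 0.
Proof.
move=> /not_all_ex_not nH; have [lam {}nH] := nH.
have [lam0 /not_all_ex_not[i /eqP lami]] := imply_to_and _ _ nH.
by exists lam => //; exists i.
Qed.

(** With a common order bound [c], the binomial estimate for the constant shift [c] forces a
    relation among more than [n] vectors. *)
Lemma dindep_le (k : nat) (f : 'I_k -> 'I_n -> diffop R m) : dindep f -> (k <= n)%N.
Proof.
move=> indep_f; rewrite leqNgt; apply/negP => lt_nk.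
pose c := (\max_(ij : 'I_k * 'I_n) msize (f ij.1 ij.2))%N.
have le_fc i j : (msize (f i j) <= c.+1)%N.
  by apply: leqW; apply: (leq_bigmax (i, j)).
have lt_sum := sum_bin_shift_lt (e := fun=> c) (leqnn (2 ^ m * \sum_(j < n) c)).
have [|lam [[i lami] _ lam0]] := op_relation le_fc _ (t := 2 ^ m * \sum_(j < n) c).
  by apply: leq_trans lt_sum _; rewrite leq_mul2r lt_nk orbT.
by rewrite (indep_f lam lam0) eqxx in lami.
Qed.

Definition fcons (k : nat) v (f : 'I_k -> 'I_n -> diffop R m) (i : 'I_k.+1) :=
  if unlift ord0 i is Some i' then f i' else v.

Lemma fcons0 k v (f : 'I_k -> 'I_n -> diffop R m) : fcons v f ord0 = v.
Proof. by rewrite /fcons unlift_none. Qed.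

Lemma fconsS k v (f : 'I_k -> 'I_n -> diffop R m) i : fcons v f (lift ord0 i) = f i.
Proof. by rewrite /fcons liftK. Qed.

Lemma sum_fcons (k : nat) v (f : 'I_k -> 'I_n -> diffop R m) lam j :
  \sum_i opmul d (lam i) (fcons v f i j) =
  opmul d (lam ord0) (v j) + \sum_i opmul d (lam (lift ord0 i)) (f i j).
Proof.
by rewrite big_ord_recl fcons0; under eq_bigr do rewrite fconsS.
Qed.

End Rank.

(** * Closure properties of generated submodules *)

Section Generation.
Variables (R : fieldType) (m : nat) (d : 'I_m -> R -> R) (hd : is_diff_field d).
Variables (n : nat) (S : ('I_n -> diffop R m) -> Prop).
Implicit Types (p q : diffop R m) (u v : 'I_n -> diffop R m).

Lemma in_gen_ext u v : u =1 v -> in_gen d S u -> in_gen d S v.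
Proof.
by move=> uv [k [lam [f [Sf u_f]]]]; exists k, lam, f; split=> // j; rewrite -uv.
Qed.

Lemma in_gen_mem v : S v -> in_gen d S v.
Proof.
by move=> Sv; exists 1%N, (fun=> 1), (fun=> v); split=> // j; rewrite big_ord1 opmul1l.
Qed.

Lemma in_gen0 : in_gen d S (fun=> 0).
Proof.
exists 0%N, (fun=> 0), (fun=> fun=> 0); split=> [[]//|j].
by rewrite big_ord0.
Qed.

Lemma in_genD u v : in_gen d S u -> in_gen d S v -> in_gen d S (fun j => u j + v j).
Proof.
move=> [k [lam [f [Sf u_f]]]] [k' [lam' [f' [Sf' v_f]]]].
pose glue T (x : 'I_k -> T) (y : 'I_k' -> T) i :=
  match split i with inl i => x i | inr i => y i end.
exists (k + k')%N, (glue _ lam lam'), (glue _ f f'); split=> [i|j].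
  by rewrite /glue; case: (split i).
rewrite u_f v_f big_split_ord /glue; congr (_ + _); apply: eq_bigr => i _.
  by rewrite (unsplitK (inl i : 'I_k + 'I_k')).
by rewrite (unsplitK (inr i : 'I_k + 'I_k')).
Qed.

Lemma in_genM p v : in_gen d S v -> in_gen d S (fun j => opmul d p (v j)).
Proof.
move=> [k [lam [f [Sf v_f]]]]; exists k, (fun i => opmul d p (lam i)), f; split=> // j.
by rewrite v_f (opmul_sumr hd); apply: eq_bigr => i _; rewrite (opmulA hd).
Qed.

Lemma in_gen_sum (I : finType) (F : I -> 'I_n -> diffop R m) :
  (forall i, in_gen d S (F i)) -> in_gen d S (fun j => \sum_i F i j).
Proof.
move=> SF; elim: (index_enum I) => [|i s IHs].
  by apply: in_gen_ext in_gen0 => j; rewrite big_nil.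
by apply: in_gen_ext (in_genD (SF i) IHs) => j; rewrite big_cons.
Qed.

End Generation.

(** * Torsion modulo a finite family *)

Section Torsion.
Variables (R : fieldType) (m : nat) (d : 'I_m -> R -> R) (hd : is_diff_field d).
Implicit Types (p q : diffop R m).

(** Two vectors in a free module of rank one are dependent. In a relation between [p] and [q] the
    factor of [p] is nonzero, since otherwise [q != 0] would make both factors vanish. *)
Lemma ore_condition p q : q != 0 ->
  exists a b : diffop R m, a != 0 /\ opmul d a p = opmul d b q.
Proof.
move=> q_neq0; pose f := fcons (fun=> p) (fun (_ : 'I_1) (_ : 'I_1) => q).
have [|lam [i lami] lam0] := @not_dindepP R m d 1 2 f.
  by move/(dindep_le hd).
have := lam0 ord0; rewrite sum_fcons big_ord1 => /eqP; rewrite addr_eq0 => /eqP lam_eq.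
have [lam00|lam_neq0] := eqVneq (lam ord0) 0; last first.
  by exists (lam ord0), (- lam (lift ord0 ord0)); rewrite opmulNl.
have lam10 : lam (lift ord0 ord0) = 0.
  have [] // := opmul_eq0 hd (p := lam (lift ord0 ord0)) (q := q); last first.
    by move=> q0; rewrite q0 eqxx in q_neq0.
  by apply/eqP; rewrite -oppr_eq0 -lam_eq lam00 opmul0l.
move: lami; have [->|[i' ->]] : i = ord0 \/ exists i', i = lift ord0 i'.
- by case: (unliftP ord0 i) => [i' ->|]; [right; exists i' | left].
- by rewrite lam00 eqxx.
- by rewrite (ord1 i') lam10 eqxx.
Qed.

Variable n : nat.
Implicit Types (u v : 'I_n -> diffop R m).

Definition tors (k : nat) (f : 'I_k -> 'I_n -> diffop R m) v : Prop :=
  exists2 q, q != 0 & exists lam : 'I_k -> diffop R m,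
    forall j, opmul d q (v j) = \sum_i opmul d (lam i) (f i j).

Section Tors.
Variables (k : nat) (f : 'I_k -> 'I_n -> diffop R m).

Lemma tors_ext u v : u =1 v -> tors f u -> tors f v.
Proof. by move=> uv [q q0 [lam qu]]; exists q => //; exists lam => j; rewrite -uv. Qed.

Lemma tors0 : tors f (fun=> 0).
Proof.
exists 1; first exact: oner_neq0.
by exists (fun=> 0) => j; rewrite (opmul0r hd) big1 // => i _; rewrite opmul0l.
Qed.

Lemma opmul_neq0 p q : p != 0 -> q != 0 -> opmul d p q != 0.
Proof. by move=> p0 q0; apply/eqP => /(opmul_eq0 hd)[]; apply/eqP. Qed.

(** The Ore condition provides a common left multiple [a p = b q] of the two multipliers. *)
Lemma torsD u v : tors f u -> tors f v -> tors f (fun j => u j + v j).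
Proof.
move=> [p p_neq0 [lam pu]] [q q_neq0 [mu qv]].
have [a [b [a_neq0 ab]]] := ore_condition p q_neq0.
exists (opmul d a p); first exact: opmul_neq0.
exists (fun i => opmul d a (lam i) + opmul d b (mu i)) => j.
under eq_bigr do rewrite opmulDl -!(opmulA hd).
rewrite big_split -!(opmul_sumr hd) -pu -qv !(opmulA hd) -ab.
by rewrite (opmulDr hd).
Qed.

Lemma torsM p v : tors f v -> tors f (fun j => opmul d p (v j)).
Proof.
move=> [q q_neq0 [lam qv]]; have [a [b [a_neq0 ab]]] := ore_condition p q_neq0.
exists a => //; exists (fun i => opmul d b (lam i)) => j.
under eq_bigr do rewrite -(opmulA hd).
by rewrite -(opmul_sumr hd) -qv !(opmulA hd) ab.
Qed.

Lemma tors_in_gen (S : ('I_n -> diffop R m) -> Prop) v :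
  (forall u, S u -> tors f u) -> in_gen d S v -> tors f v.
Proof.
move=> torsS [l [lam [g [Sg v_g]]]]; apply: tors_ext (fun j => esym (v_g j)) _.
elim: (index_enum _) => [|i s IHs].
  by apply: tors_ext tors0 => j; rewrite big_nil.
by apply: tors_ext (torsD (torsM (lam i) (torsS _ (Sg i))) IHs) => j; rewrite big_cons.
Qed.

Lemma tors_cancel p v : p != 0 -> tors f (fun j => opmul d p (v j)) -> tors f v.
Proof.
move=> p_neq0 [q q_neq0 [lam qpv]]; exists (opmul d q p); first exact: opmul_neq0.
by exists lam => j; rewrite -(opmulA hd).
Qed.

(** In a relation among [v] and [f] the factor of [v] is nonzero, as otherwise independence of [f]
    would make all factors vanish. *)
Lemma tors_fcons v : dindep d f -> ~ dindep d (fcons v f) -> tors f v.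
Proof.
move=> indep_f /not_dindepP[lam [i lami] lam0].
have lam_eq j : opmul d (lam ord0) (v j) = \sum_i opmul d (- lam (lift ord0 i)) (f i j).
  under eq_bigr do rewrite opmulNl; rewrite sumrN; apply/eqP.
  by rewrite -addr_eq0 -sum_fcons lam0.
exists (lam ord0); last by exists (fun i => - lam (lift ord0 i)).
apply: contraNneq lami => lam00.
have lamS i' : lam (lift ord0 i') = 0.
  apply/eqP; rewrite -oppr_eq0; apply/eqP; move: i'; apply: indep_f => j.
  by rewrite -lam_eq lam00 opmul0l.
by case: (unliftP ord0 i) => [i'|] ->; rewrite ?lamS ?lam00.
Qed.

End Tors.

Definition unit_vec (j0 : 'I_n) (p : diffop R m) : 'I_n -> diffop R m :=
  fun j => if j == j0 then p else 0.

Lemma opmul_unit_vec j0 p q j : opmul d p (unit_vec j0 q j) = unit_vec j0 (opmul d p q) j.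
Proof. by rewrite /unit_vec; case: eqP => // _; rewrite (opmul0r hd). Qed.

(** Otherwise each [m_j] has a multiple [q_j m_j], with [q_j] nonzero, in the span of [k] vectors.
    The [n] rows of coefficients would be independent in a module of rank [k < n], because a
    relation among them is one among the [q_j m_j]. *)
Lemma not_tors_unit_vec (k : nat) (f : 'I_k -> 'I_n -> diffop R m) : (k < n)%N ->
  exists j0, ~ tors f (unit_vec j0 1).
Proof.
move=> lt_kn; apply: not_all_ex_not => all_tors.
have /fin_all_exists[q q_lam] j0 : exists q : diffop R m, q != 0 /\
    exists lam : 'I_k -> diffop R m, forall j,
      unit_vec j0 q j = \sum_i opmul d (lam i) (f i j).
  have [q q_neq0 [lam qj]] := all_tors j0.
  exists q; split=> //; exists lam => j.
  by rewrite -qj opmul_unit_vec (opmul1r hd).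
have [lam lam_eq] := fin_all_exists (fun j0 => (q_lam j0).2).
suff : dindep d lam by move/(dindep_le hd); rewrite leqNgt lt_kn.
move=> mu mu0 j; have : opmul d (mu j) (q j) = 0; last first.
  case/(opmul_eq0 hd) => // qj0; have [] := q_lam j.
  by rewrite qj0 eqxx.
transitivity (\sum_i opmul d (mu i) (unit_vec i (q i) j)).
  rewrite (bigD1 j) //= big1 ?addr0 => [|i neq_ij]; first by rewrite /unit_vec eqxx.
  by rewrite /unit_vec eq_sym (negPf neq_ij) (opmul0r hd).
under eq_bigr do rewrite lam_eq (opmul_sumr hd).
rewrite exchange_big big1 //= => i _.
under eq_bigr do rewrite (opmulA hd).
by rewrite -opmul_suml mu0 opmul0l.
Qed.

(* If a maximal independent family [f] in [S] had fewer than [n] members, some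
   basis vector would not be torsion modulo [f]; but all of [S] is, hence so is
   the given multiple of that basis vector. *)
Lemma exists_dindep (S : ('I_n -> diffop R m) -> Prop) :
  (forall j0, exists2 p, p != 0 & in_gen d S (unit_vec j0 p)) ->
  exists2 f : 'I_n -> 'I_n -> diffop R m, forall i, S (f i) & dindep d f.
Proof.
move=> torsS; pose P k := exists2 f : 'I_k -> 'I_n -> diffop R m,
  forall i, S (f i) & dindep d f.
suff P_le k : (k <= n)%N -> P k by apply: P_le.
elim: k => [_|k IHk lt_kn]; first by exists (fun=> fun=> 0) => [[]|lam _ []].
have [f Sf indep_f] := IHk (ltnW lt_kn); apply: NNPP => nP.
have torsSf v : S v -> tors f v.
  move=> Sv; apply: tors_fcons => // indep_vf; apply: nP; exists (fcons v f) => // i.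
  by rewrite /fcons; case: unlift.
have [j0] := not_tors_unit_vec f lt_kn; apply.
have [p p_neq0 Sp] := torsS j0; apply: (tors_cancel p_neq0).
apply: tors_ext (tors_in_gen torsSf Sp) => j.
by rewrite opmul_unit_vec (opmul1r hd).
Qed.

End Torsion.

(** If no nonzero operator carried [m_j0] into [N], the monomials of order at most [s] applied to
    [m_j0] would be independent modulo [N]. The dimension would then lie between ['C(s + m, m)] and
    [n * 'C(s + m, m)], which [a m = 0] excludes. *)
Lemma kolchin_torsion (R : fieldType) (m n : nat) (d : 'I_m -> R -> R)
    (Sigma : ldp R m n -> Prop) :
  kolchin_am_zero d Sigma ->
  forall j0, exists2 p, p != 0 & inN d Sigma (unit_vec j0 p).
Proof.
move=> [dd [a [_ [am0 [s0 Q]]]]] j0; apply: NNPP => no_p.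
have free_j0 p : inN d Sigma (unit_vec j0 p) -> p = 0.
  by move=> Np; apply/eqP/negPn/negP => p_neq0; apply: no_p; exists p.
apply: (bin_comb_neq (dd := dd.+1) (n := n) (s0 := s0) am0) => s /Q.
move=> [k [[[v [v_s indep_v]] max_k] <-]]; apply/andP; split.
  rewrite lez_nat leqNgt; apply/negP; rewrite -card_bmultinom => lt_k.
  (* Any [k.+1] of the monomials contradict the maximality of [k]. *)
  pose g (i : 'I_k.+1) : 'X_{1..m < s.+1} := enum_val (widen_ord lt_k i).
  have g_inj : injective g by move=> i i' /enum_val_inj/(congr1 val)/= /val_inj.
  apply: (max_k (fun i => unit_vec j0 'X_[g i])); split=> [i j|c].
    rewrite op_ord_msize /unit_vec; case: eqP => _; last by rewrite mmeasure0.
    by rewrite msizeX bmdeg.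
  move=> Nc i; have c0 : \sum_i c i *: 'X_[R, g i] = 0.
    apply: free_j0; apply: in_gen_ext Nc => j; rewrite /unit_vec.
    by case: eqP => // _; rewrite big1 // => i' _; rewrite scaler0.
  have := congr1 (mcoeff (g i)) c0; rewrite mcoeff0 raddf_sum (bigD1 i) //=.
  rewrite mcoeffZ mcoeffX eqxx mulr1 big1 ?addr0 // => i' neq_i.
  by rewrite mcoeffZ mcoeffX -bmeqP (inj_eq g_inj) (negPf neq_i) mulr0.
rewrite -PoszM lez_nat leqNgt; apply/negP => lt_k.
(* More than [n * 'C(s + m, m)] vectors of [M_s] are dependent even before passing to the
   quotient. *)
pose A (i : 'I_k) (jb : 'I_n * 'X_{1..m < s.+1}) := (v i jb.1)@_jb.2.
have [|x [i xi_neq0] x0] := nontrivial_relation A.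
  by rewrite card_prod !card_ord card_bmultinom.
have xv0 j : \sum_i x i *: v i j = 0.
  apply/mpolyP => b; rewrite mcoeff0 raddf_sum /=.
  under eq_bigr do rewrite mcoeffZ.
  have [lt_b|le_b] := ltnP (mdeg b) s.+1; first exact: (x0 (j, BMultinom lt_b)).
  rewrite big1 // => i' _; rewrite (msize_leP s.+1 _).2 ?mulr0 //.
  by rewrite -op_ord_msize v_s.
move: xi_neq0; rewrite indep_v ?eqxx //.
by apply: in_gen_ext (in_gen0 _ _) => j; rewrite xv0.
Qed.

(** * Independence under extension of the differential field *)

Section ScalarExtension.
Variables (F G : fieldType) (m : nat) (d : 'I_m -> F -> F) (dG : 'I_m -> G -> G).
Variable iota : {rmorphism F -> G}.
Hypotheses (hd : is_diff_field d) (hext : is_diff_ext d dG iota).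

Lemma map_dmon a q : map_mpoly iota (dmon d a q) = dmon dG a (map_mpoly iota q).
Proof.
elim/mnm_ind_add: a => [|a i IHa]; first by rewrite !dmon0.
rewrite !dmonS // -?IHa; last exact: hext.1.
rewrite /dleft rmorphD rmorphM /= map_mpolyX; congr (_ + _).
apply/mpolyP => b; rewrite mcoeff_map_mpoly (mcoeff_map_der (hd.1 i)).
rewrite (mcoeff_map_der (hext.1.1 i)) mcoeff_map_mpoly.
exact: hext.2.
Qed.

(** A relation over [G] has bounded order, so it solves a finite linear system with entries from
    [F]; a nonzero solution over [G] implies one over [F]. *)
Lemma dindep_lift (n k : nat) (f : 'I_k -> 'I_n -> diffop F m) :
  dindep d f -> dindep dG (fun i j => map_mpoly iota (f i j)).
Proof.
move=> indep_f lam lam0 i0; apply/eqP/negPn/negP => lam_neq0.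
pose t := (\max_i msize (lam i))%N.
pose c := (\max_(ij : 'I_k * 'I_n) msize (f ij.1 ij.2))%N.
have le_lam i : (msize (lam i) <= t.+1)%N by apply: leqW; apply: leq_bigmax.
have le_fc i j : (msize (f i j) <= c.+1)%N.
  by apply: leqW; apply: (leq_bigmax (i, j)).
have le_fGc i j : (msize (map_mpoly iota (f i j)) <= c.+1)%N.
  apply/msize_leP => a le_ca.
  by rewrite mcoeff_map_mpoly ((msize_leP c.+1 _).2 (le_fc i j)) //; apply: raddf0.
pose x (ia : 'I_k * 'X_{1..m < t.+1}) := (lam ia.1)@_ia.2.
have x_rel : forall jb, \sum_ia x ia * iota (rel_coeff d (e := fun=> c) f ia jb) = 0.
  move=> jb; rewrite -[RHS]((rel_coeffP hext.1 x le_fGc).2 _ jb) /rel_coeff.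
    by apply: eq_bigr => ia _; rewrite -map_dmon mcoeff_map_mpoly.
  move=> j; rewrite -[RHS](lam0 j); apply: eq_bigr => i _.
  by rewrite (op_of_coeff (le_lam i)).
have [|y [[i a] yia_neq0] /(rel_coeffP hd y le_fc)/indep_f/(_ i) y0] :=
    @relation_descent F G iota _ _ (rel_coeff d (t := t) (e := fun=> c) f).
  have lt_lead : (mdeg (mlead (lam i0)) < t.+1)%N.
    by apply: leq_trans (le_lam i0); rewrite -mlead_deg.
  exists x => //; exists (i0, BMultinom lt_lead).
  by rewrite /x /= mleadc_eq0.
move/(congr1 (mcoeff a)): y0; rewrite mcoeff_op_of mcoeff0.
exact/eqP.
Qed.

End ScalarExtension.

(** * The generator *)

Section CommutingDerivation.
Variables (R : fieldType) (m : nat) (d : 'I_m -> R -> R) (hd : is_diff_field d).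
Variables (delta : R -> R) (hdelta : derivation delta).
Hypothesis delta_comm : forall i x, delta (d i x) = d i (delta x).
Implicit Types p q : diffop R m.

Lemma map_der_dmon a q :
  map_mpoly delta (dmon d a q) = dmon d a (map_mpoly delta q).
Proof.
elim/mnm_ind_add: a => [|a i IHa]; first by rewrite !dmon0.
rewrite !dmonS // -IHa !dleftE (map_derD hdelta) (map_derM hdelta m).2.
rewrite (map_derX hdelta) mulr0 addr0; congr (_ + _).
apply/mpolyP => b; rewrite (mcoeff_map_der hdelta) (mcoeff_map_der (hd.1 i)).
by rewrite (mcoeff_map_der (hd.1 i)) (mcoeff_map_der hdelta).
Qed.

(** As [delta] commutes with every [d i], its action on coefficients satisfies the Leibniz rule for
    the skew product. *)
Lemma map_der_opmul p q : map_mpoly delta (opmul d p q) =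
  opmul d (map_mpoly delta p) q + opmul d p (map_mpoly delta q).
Proof.
elim/mpolyind: p => [|c a p _ _ IHp].
  rewrite opmul0l -mpolyC0 !(map_derC hdelta) (der0 hdelta) mpolyC0.
  by rewrite !opmul0l addr0.
rewrite opmulDl !(map_derD hdelta) IHp !opmulDl addrACA; congr (_ + _).
rewrite !opmulZl !opmulX !(map_derZ hdelta) (map_derX hdelta) scaler0 add0r.
by rewrite map_der_dmon opmulZl opmulX addrC.
Qed.

End CommutingDerivation.

Section Generator.
Variables (G : fieldType) (m : nat) (d : 'I_m -> G -> G) (hd : is_diff_field d).
Hypothesis char0 : [pchar G] =i pred0.
Variable x : 'I_m -> G.
Hypothesis dx : forall i k, d i (x k) = (i == k)%:R.
Implicit Types p q L : diffop G m.

(** The commutator of [L] with [x k] is the formal derivative of [L] in the symbol of [d k], by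
    induction from [d i (x k) = (i == k)%:R]. *)
Lemma opmul_x L k q :
  opmul d L (x k *: q) = x k *: opmul d L q + opmul d L^`M(k) q.
Proof.
elim/mpolyind: L => [|c a L _ _ IHL].
  by rewrite mderiv0 !opmul0l scaler0 addr0.
rewrite mderivD !opmulDl IHL scalerDr addrACA; congr (_ + _).
rewrite mderivZ !opmulZl scalerA [x k * c]mulrC -scalerA -scalerDr; congr (_ *: _).
rewrite !opmulX; elim/mnm_ind_add: a => [|a i IHa].
  by rewrite !dmon0 mpolyX0 -mpolyC1 mderivC opmul0l addr0.
rewrite !dmonS // IHa dleftD // dleftZ // dx dleft_opmul // -addrA; congr (_ + _).
rewrite dleftE mpolyXD mderivM [in RHS]opmulDl.
rewrite (map_der_deriv (hd.1 i)) (map_derX (hd.1 i)) mderiv0 addr0 addrC.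
congr (_ + _); rewrite mderivX mnm1E.
have [->|_] := eqVneq i k; last by rewrite !scale0r mulr0 opmul0l.
by rewrite !scale1r -{1}[U_(k)%MM]add0m addmK mpolyX0 mulr1 opmulX.
Qed.

Let xpow (g : 'X_{1..m}) : G := mmap1 x g.

(** Characteristic 0 enters here: an exponent [a i != 0] stays nonzero as a scalar. *)
Lemma mderiv_eq0_const L : (forall i, L^`M(i) = 0) -> L = (L@_0)%:MP.
Proof.
move=> dL0; apply/mpolyP => a; rewrite mcoeffC.
have [->|a_neq0] := eqVneq a 0%MM; first by rewrite mulr1.
rewrite mulr0; have [i ai_neq0] := mnm_neq0P a_neq0.
have le_ia : (U_(i) <= a)%MM by rewrite lep1mP.
have := congr1 (mcoeff (a - U_(i))%MM) (dL0 i).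
rewrite mcoeff_deriv submK // mcoeff0 -mulr_natr => /eqP; rewrite mulf_eq0.
by rewrite (pcharf0P G).1 // orbF => /eqP.
Qed.

(* Each commutator of [L] with some [x_i] lowers the order, until only a nonzero
   scalar is left. *)
Lemma span_xpow_1 (K : diffop G m -> Prop) (t : nat) L :
  (forall p q, K p -> K q -> K (p + q)) -> (forall c p, K p -> K (c *: p)) ->
  L != 0 -> (msize L <= t.+1)%N ->
  (forall g, (mdeg g <= t)%N -> K (opmul d L (xpow g)%:MP)) -> K 1.
Proof.
move=> KD KZ; elim: t L => [|t IHt] L L_neq0 le_L KL.
all: have [[i di_neq0]|no_i] := classic (exists i, L^`M(i) <> 0); last first.
(* If all formal derivatives vanish, [L] is a nonzero scalar [c] and [1 = c^-1 L x^0]. *)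
1,3: have Lc : L = (L@_0)%:MP
       by apply: mderiv_eq0_const => i; apply: NNPP => Li; apply: no_i; exists i.
1,2: have c_neq0 : L@_0 != 0 by apply: contraNneq L_neq0 => c0; rewrite Lc c0.
1,2: have -> : 1 = (L@_0)^-1 *: opmul d L (xpow 0)%:MP;
       [by rewrite {2}Lc opmulC /xpow mmap11 scalerA mulVf ?scale1r
       |by apply/KZ/KL; rewrite mdeg0].
  by case: di_neq0; rewrite (msize1_polyC le_L) mderivC.
apply: (IHt L^`M(i)) => [||g le_g]; first exact/eqP.
  apply/msize_leP => a le_a; rewrite mcoeff_deriv (msize_leP t.+2 L).2 ?mul0rn //.
  by rewrite mdegD mdeg1 addn1.
(* [[L, x_i] x^g = L x_i x^g - x_i L x^g], and [x_i x^g] has degree at most [t.+1], so both terms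
   are covered by [KL]. *)
have -> : opmul d L^`M(i) (xpow g)%:MP =
    opmul d L (xpow (U_(i) + g))%:MP + (- x i) *: opmul d L (xpow g)%:MP.
  rewrite /xpow commr_mmap1_M; last by move=> *; apply: mulrC.
  rewrite mmap1U mpolyCM mul_mpolyC opmul_x scaleNr addrAC subrr add0r //.
apply: KD; first by apply: KL; rewrite mdegD mdeg1 add1n.
by apply/KZ/KL/leqW.
Qed.

Variables (n : nat) (S : ('I_n -> diffop G m) -> Prop).
Variables (e : 'I_n -> nat) (f : 'I_n -> 'I_n -> diffop G m) (c : 'I_n -> G).
Hypotheses (Sf : forall i, S (f i)) (indep_f : dindep d f).
Hypothesis ord_f : forall i j, (op_ord (f i j) <= e j)%N.
Let t := (2 ^ m * \sum_(j < n) e j)%N.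

(** [psi] has order 0, so counting applies to the [n.+1] vectors [psi, f_1, ..., f_n]; the factor
    [L] of [psi] is nonzero because the [f_i] are independent. *)
Lemma psi_relation : exists2 L, L != 0 /\ (msize L <= t.+1)%N &
  exists B : 'I_n -> diffop G m,
    forall j, opmul d L (c j)%:MP + \sum_i opmul d (B i) (f i j) = 0.
Proof.
pose h := fcons (fun j => (c j)%:MP : diffop G m) f.
have [||lam [[i lami] le_lam lam0]] := @op_relation G m d hd n n.+1 t e h.
- move=> i j; rewrite /h /fcons; case: unlift => [i'|]; first by rewrite -op_ord_msize.
  by rewrite msizeC; case: eqP.
- exact: sum_bin_shift_lt.
exists (lam ord0); last first.
  by exists (fun i => lam (lift ord0 i)) => j; rewrite -[RHS](lam0 j) sum_fcons.
split=> //; apply: contraNneq lami => lam00.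
case: (unliftP ord0 i) => [i'|] ->; last by rewrite lam00.
apply/eqP; move: i'; apply: indep_f => j.
by rewrite -[RHS](lam0 j) sum_fcons lam00 opmul0l add0r.
Qed.

(** The properties of the partial derivative along [u_(j, g)] that the argument uses. The index 0 is
    left out because its [c] is the constant 1. *)
Hypothesis generic : forall j g, val j != 0%N -> (mdeg g <= t)%N ->
  exists delta : G -> G, [/\ derivation delta,
    forall i y, delta (d i y) = d i (delta y),
    forall i k, map_mpoly delta (f i k) = 0 &
    forall k, delta (c k) = (k == j)%:R * xpow g].

(** [p m_j] is congruent to some [q psi] with [q] of order at most [t]; for fixed [j], such [p] are
    closed under sums and left scalars, as [span_xpow_1] requires. *)
Let multiple (j : 'I_n) (p : diffop G m) : Prop :=
  exists2 q, (msize q <= t.+1)%N &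
    in_gen d S (fun k => opmul d q (c k)%:MP - (if k == j then p else 0)).

Lemma multipleD j p q : multiple j p -> multiple j q -> multiple j (p + q).
Proof.
move=> [p' le_p' Sp] [q' le_q' Sq]; exists (p' + q').
  by apply: leq_trans (msizeD_le _ _) _; rewrite geq_max le_p'.
apply: in_gen_ext (in_genD Sp Sq) => k; rewrite opmulDl addrACA -opprD.
by congr (_ - _); case: eqP => _; rewrite ?addr0.
Qed.

Lemma multipleZ j a p : multiple j p -> multiple j (a *: p).
Proof.
move=> [q le_q Sq]; exists (a *: q); first exact: leq_trans (msizeZ_le _ _) le_q.
apply: in_gen_ext (in_genM hd a%:MP Sq) => k; rewrite opmulC scalerBr opmulZl.
by congr (_ - _); case: eqP => _; rewrite ?scaler0.
Qed.

Lemma multiple1 j : val j != 0%N -> multiple j 1.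
Proof.
move=> j_neq0; have [L [L_neq0 le_L] [B LB]] := psi_relation.
apply: (span_xpow_1 (multipleD (j := j)) (multipleZ (j := j)) L_neq0 le_L) => g le_g.
have [delta [hdelta delta_d delta_f delta_c]] := generic j_neq0 le_g.
(* Applying [delta] to [L psi + sum_i B_i f_i = 0] gives [delta(L) psi + L x^g m_j + sum_i
   delta(B_i) f_i = 0]. *)
exists (- map_mpoly delta L).
  by rewrite msizeN (leq_trans (msize_map_der hdelta _)).
have SB : in_gen d S (fun k => \sum_i opmul d (map_mpoly delta (B i)) (f i k)).
  by apply: in_gen_sum => i; apply: in_genM => //; apply: in_gen_mem.
apply: in_gen_ext SB => k; have := congr1 (map_mpoly delta) (LB k).
rewrite -mpolyC0 (map_derC hdelta) (der0 hdelta) mpolyC0 (map_derD hdelta).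
rewrite (map_der_sum hdelta).
under eq_bigr do rewrite (map_der_opmul hd hdelta delta_d) delta_f (opmul0r hd) addr0.
rewrite (map_der_opmul hd hdelta delta_d) (map_derC hdelta) delta_c opmulNl -opprD.
move/eqP; rewrite addrC addr_eq0 => /eqP ->; congr (- (_ + _)).
by case: eqP => _; rewrite ?mul1r // mul0r mpolyC0 (opmul0r hd).
Qed.

Hypothesis c0 : forall j, val j = 0%N -> c j = 1.

Lemma generator_bound j : exists2 lam, (op_ord lam <= t)%N &
  in_gen d S (fun k => opmul d lam (c k)%:MP - (k == j)%:R).
Proof.
suff [q le_q Sq] : multiple j 1.
  exists q; first by rewrite op_ord_msize.
  by apply: in_gen_ext Sq => k; case: eqP.
have [j0|] := eqVneq (val j) 0%N; last exact: multiple1.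
have /fin_all_exists[q qP] i : exists q, val i != 0%N -> (msize q <= t.+1)%N /\
    in_gen d S (fun k => opmul d q (c k)%:MP - (if k == i then 1 else 0)).
  have [_|i_neq0] := eqVneq (val i) 0%N; first by exists 0.
  by have [q] := multiple1 i_neq0; exists q.
(* [m_0 = psi - sum_(i > 0) c_i m_i] *)
pose w i := if val i == 0%N then 0 else - c i.
(* Left multiplication by scalars does not raise the order, so the bound [t] persists. *)
exists (1 + \sum_i w i *: q i).
  apply: leq_trans (msizeD_le _ _) _; rewrite geq_max msize1 /=.
  rewrite (leq_trans (msize_sum _ _ _)) //; apply/bigmax_leqP_seq => i _ _.
  rewrite /w; have [_|i_neq0] := eqVneq (val i) 0%N; first by rewrite scale0r mmeasure0.
  by apply: leq_trans (msizeZ_le _ _) (qP i i_neq0).1.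
have Sw : in_gen d S (fun k => \sum_i
    opmul d (w i)%:MP (opmul d (q i) (c k)%:MP - (if k == i then 1 else 0))).
  apply: in_gen_sum => i; rewrite /w.
  have [_|i_neq0] := eqVneq (val i) 0%N; last exact: in_genM (qP i i_neq0).2.
  by apply: in_gen_ext (in_gen0 _ _) => k; rewrite opmulC scale0r.
apply: in_gen_ext Sw => k; rewrite opmulDl opmul1l opmul_suml.
under eq_bigr do rewrite opmulC scalerBr -opmulZl.
rewrite sumrB -addrA addrCA; congr (_ + _).
rewrite (bigD1 k) //= eqxx big1 ?addr0 => [|i neq_ik]; last first.
  by rewrite eq_sym (negPf neq_ik) scaler0.
rewrite /w; have [k0|k_neq0] := eqVneq (val k) 0%N.
  have -> : k = j by apply: val_inj; rewrite k0.
  by rewrite eqxx c0 // scale0r oppr0 mpolyC1 subrr.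
have -> : (k == j) = false by apply: contraNF k_neq0 => /eqP ->; rewrite j0.
by rewrite subr0 scaleNr opprK -alg_mpolyC.
Qed.

(** Substitute [lam_j psi] for [m_j] in [v = sum_j v_j m_j]. *)
Lemma generator_span v : exists lam,
  in_gen d S (fun k => v k - opmul d lam (c k)%:MP).
Proof.
have /fin_all_exists[lam lamP] j : exists lam,
    in_gen d S (fun k => opmul d lam (c k)%:MP - (k == j)%:R).
  by have [lam _] := generator_bound j; exists lam.
exists (\sum_j opmul d (v j) (lam j)).
have Sv : in_gen d S (fun k => \sum_j
    opmul d (- v j) (opmul d (lam j) (c k)%:MP - (k == j)%:R)).
  by apply: in_gen_sum => j; apply: in_genM.
apply: in_gen_ext Sv => k; rewrite opmul_suml.
under eq_bigr do rewrite opmulDr // opmulNl opmulNr // opmulNl opprK addrC opmulA //.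
rewrite sumrB; congr (_ - _); rewrite (bigD1 k) //= eqxx opmul1r // big1 ?addr0 //.
by move=> j neq_jk; rewrite eq_sym (negPf neq_jk) opmul0r.
Qed.

End Generator.

(** * The generic extension *)

(** The condition is boolean so that [xchoose] can pick a numerator and a denominator. *)
Lemma frac_numden (R : idomainType) (z : {fraction R}) :
  exists nd : R * R, (nd.2 != 0) && (z == tofrac nd.1 / tofrac nd.2).
Proof.
elim/quotW: z => r; exists (frac r); rewrite denom_ratioP /=.
have d_neq0 : tofrac (frac r).2 != 0 by rewrite tofrac_eq0 denom_ratioP.
rewrite -(inj_eq (mulIf d_neq0)) divfK //; apply/eqP.
unlock FracField.tofrac; rewrite -[LHS]FracField.pi_mul.
apply/eqmodP; rewrite /= FracField.equivfE /FracField.mulf.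
rewrite !numden_Ratio ?mulf_neq0 ?oner_neq0 ?denom_ratioP //.
by rewrite !mulr1 mulrC.
Qed.

(** * Extension of derivations to the fraction field *)

Section FractionDerivation.
Variable R : idomainType.
Implicit Types (a b : R) (z : {fraction R}).
Local Notation tf := (@tofrac R).

(** The quotient rule on a chosen representative; [frac_der_div] shows that the choice does not
    matter. *)
Definition frac_der (f : R -> R) z : {fraction R} :=
  let: (a, b) := xchoose (frac_numden z) in
  tf (f a * b - a * f b) / tf b ^+ 2.

Variables (f : R -> R) (hf : derivation f).

Lemma frac_der_div a b : b != 0 ->
  frac_der f (tf a / tf b) = tf (f a * b - a * f b) / tf b ^+ 2.
Proof.
rewrite /frac_der => b_neq0; case: (xchoose _) (xchooseP (frac_numden (tf a / tf b))).
move=> a' b' /= /andP[b'_neq0].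
have tfb : tf b != 0 by rewrite tofrac_eq0.
have tfb' : tf b' != 0 by rewrite tofrac_eq0.
rewrite eqr_div // -!tofracM tofrac_eq => /eqP eq_ab.
(* Differentiating [a b' = a' b] links the derivatives of the two representatives. *)
have := congr1 f eq_ab; rewrite !hf.2 => eq_f.
apply/eqP; rewrite eqr_div ?expf_neq0 // -!tofracXn -!tofracM tofrac_eq; apply/eqP.
have {}eq_f : f a' * b = f a * b' + a * f b' - a' * f b by rewrite eq_f addrK.
transitivity ((f a' * b) * (b' * b) - (a * b') * f b' * b).
  by rewrite eq_ab; ring.
rewrite eq_f; transitivity (b' * (f a * b' * b - (a' * b) * f b)); first by ring.
by rewrite -eq_ab; ring.
Qed.

Lemma frac_der_tofrac a : frac_der f (tf a) = tf (f a).
Proof.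
rewrite -[tf a]divr1 -tofrac1 frac_der_div ?oner_eq0 // (der1 hf) mulr0 subr0 mulr1.
by rewrite tofrac1 expr1n divr1.
Qed.

Lemma frac_der_derivation : derivation (frac_der f).
Proof.
have nd z : exists a b, b != 0 /\ z = tf a / tf b.
  by have [[a b] /andP[b_neq0 /eqP]] := frac_numden z; exists a, b.
split=> y z; have [a [b [b_neq0 ->]]] := nd y; have [a' [b' [b'_neq0 ->]]] := nd z.
  rewrite addf_div ?tofrac_eq0 // -!tofracM -tofracD !frac_der_div ?mulf_neq0 //.
  rewrite addf_div ?expf_neq0 ?tofrac_eq0 // -exprMn -!tofracM; congr (_ / _).
  rewrite -!tofracXn -!tofracM -tofracD; congr tf.
  by rewrite hf.1 !hf.2; ring.
rewrite mulf_div -!tofracM !frac_der_div ?mulf_neq0 //.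
rewrite !mulf_div addf_div ?mulf_neq0 ?expf_neq0 ?tofrac_eq0 //.
apply/eqP; rewrite eqr_div ?mulf_neq0 ?expf_neq0 ?tofrac_eq0 ?mulf_neq0 //.
rewrite -!tofracXn -!tofracM -!tofracD -!tofracM tofrac_eq; apply/eqP.
by rewrite !hf.2; ring.
Qed.

End FractionDerivation.

Lemma frac_der_comm (R : idomainType) (f g : R -> R) :
  derivation f -> derivation g -> (forall a, f (g a) = g (f a)) ->
  forall z, frac_der f (frac_der g z) = frac_der g (frac_der f z).
Proof.
move=> hf hg fg z; have [[a b] /andP[b_neq0 /eqP ->]] := frac_numden z.
move: (b_neq0) => /= b0; rewrite !frac_der_div //= -!tofracXn.
rewrite !frac_der_div ?expf_neq0 //; congr (tofrac _ / _).
rewrite !expr2 !(hf.1, hf.2, hg.1, hg.2, derN hf, derN hg) !fg; ring.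
Qed.

Section GenericExtension.
Variables (F : fieldType) (m : nat) (d : 'I_m -> F -> F) (hd : is_diff_field d).
Variables (n t : nat).

(* Indeterminates: [x_i] for each derivation, with [d_i x_k] the Kronecker
   delta, and constants [u_(j, g)], the Taylor coefficients of a generic
   polynomial of degree [t] in the [x_i]. *)
Definition ind : finType := ('I_m + 'I_n * 'X_{1..m < t.+1})%type.
Let P : idomainType := {mpoly F[#|ind|]}.
Let xvar (i : 'I_m) : 'I_#|ind| := enum_rank (inl i : ind).
Let uvar (j : 'I_n) (g : 'X_{1..m < t.+1}) : 'I_#|ind| := enum_rank (inr (j, g) : ind).

Definition gen_field : fieldType := {fraction P}.

(** The partial derivative along [x_i] is added to the action on coefficients, so that [x_k] goes to
    the Kronecker delta and every [u_(j, g)] to 0. *)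
Definition poly_der (i : 'I_m) (p : P) : P := map_mpoly (d i) p + p^`M(xvar i).

Definition gen_der (i : 'I_m) : gen_field -> gen_field := frac_der (poly_der i).

Definition gen_iota : {rmorphism F -> gen_field} :=
  (@tofrac P \o @mpolyC #|ind| F).

Definition gen_x (i : 'I_m) : gen_field := tofrac ('X_(xvar i) : P).

Definition gen_c (j : 'I_n) : gen_field :=
  if val j == 0%N then 1
  else \sum_g tofrac ('X_(uvar j g) : P) * mmap1 gen_x g.

Lemma mderiv_derivation k : derivation (fun p : P => p^`M(k)).
Proof. by split=> p q; rewrite (mderivD, mderivM). Qed.

Lemma poly_der_derivation i : derivation (poly_der i).
Proof.
have hdi : derivation (d i) := hd.1 i.
split=> p q; rewrite /poly_der.
  by rewrite (map_derD hdi) mderivD addrACA.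
by rewrite (map_derM hdi _).2 mderivM mulrDl mulrDr addrACA.
Qed.

Lemma poly_der_comm i k p : poly_der i (poly_der k p) = poly_der k (poly_der i p).
Proof.
have hdi : derivation (d i) := hd.1 i; have hdk : derivation (d k) := hd.1 k.
rewrite /poly_der !mderivD !(map_derD hdi) !(map_derD hdk).
rewrite !(map_der_deriv hdi) !(map_der_deriv hdk).
have -> : map_mpoly (d i) (map_mpoly (d k) p) = map_mpoly (d k) (map_mpoly (d i) p).
  apply/mpolyP => a; rewrite (mcoeff_map_der hdi) (mcoeff_map_der hdk).
  by rewrite hd.2 -(mcoeff_map_der hdi) -(mcoeff_map_der hdk).
by rewrite mderiv_comm -!addrA; congr (_ + _); rewrite addrCA.
Qed.

Lemma gen_ext : is_diff_ext d gen_der gen_iota.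
Proof.
split=> [|i y]; last first.
  rewrite /gen_der /= frac_der_tofrac; last exact: poly_der_derivation.
  by rewrite /poly_der (map_derC (hd.1 i)) mderivC addr0.
split=> [i|i k z]; first exact: (frac_der_derivation (poly_der_derivation i)).
apply: frac_der_comm; try exact: poly_der_derivation.
exact: poly_der_comm.
Qed.

Lemma mderivXU (k l : 'I_#|ind|) : ('X_k : P)^`M(l) = (k == l)%:R.
Proof.
rewrite mderivX mnm1E; have [->|_] := eqVneq k l; last by rewrite scale0r.
by rewrite scale1r -{1}[U_(l)%MM]add0m addmK mpolyX0.
Qed.

Lemma gen_dx i k : gen_der i (gen_x k) = (i == k)%:R.
Proof.
rewrite /gen_der /gen_x frac_der_tofrac; last exact: poly_der_derivation.
rewrite /poly_der (map_derX (hd.1 i)) add0r mderivXU (inj_eq enum_rank_inj).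
by rewrite (inj_eq inl_inj) eq_sym rmorph_nat.
Qed.

Lemma gen_char0 : [pchar F] =i pred0 -> [pchar gen_field] =i pred0.
Proof. by move=> char0 p; rewrite (fmorph_pchar gen_iota). Qed.

(** The partial derivative along [u_(j, g)] commutes with the [gen_der i] because the [u] are
    constants. It annuls [F] and the [x_i], and [u_(j, g)] occurs only in [c_j], with coefficient
    [x^g]. *)
Lemma gen_delta (j : 'I_n) (g : 'X_{1..m < t.+1}) : val j != 0%N ->
  exists delta : gen_field -> gen_field, [/\ derivation delta,
    forall i z, delta (gen_der i z) = gen_der i (delta z),
    forall y, delta (gen_iota y) = 0 &
    forall k, delta (gen_c k) = (k == j)%:R * mmap1 gen_x g].
Proof.
move=> j_neq0; have hu := mderiv_derivation (uvar j g).
have hdelta := frac_der_derivation hu.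
have delta_u k h : frac_der (mderiv (uvar j g)) (tofrac ('X_(uvar k h) : P)) =
    ((k == j) && (h == g))%:R.
  rewrite (frac_der_tofrac hu) mderivXU (inj_eq enum_rank_inj) (inj_eq inr_inj).
  by rewrite xpair_eqE rmorph_nat.
have delta_x i : frac_der (mderiv (uvar j g)) (gen_x i) = 0.
  by rewrite (frac_der_tofrac hu) mderivXU (inj_eq enum_rank_inj) rmorph0.
have delta_xpow h : frac_der (mderiv (uvar j g)) (mmap1 gen_x h) = 0.
  elim/mnm_ind_add: h => [|h i IHh]; first by rewrite mmap11 (der1 hdelta).
  rewrite commr_mmap1_M; last by move=> *; apply: mulrC.
  by rewrite mmap1U hdelta.2 IHh delta_x mul0r mulr0 addr0.
exists (frac_der (mderiv (uvar j g))); split=> [//|i z|y|k].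
- apply: frac_der_comm => //; first exact: poly_der_derivation.
  move=> p; rewrite /poly_der mderivD mderiv_comm.
  by rewrite (map_der_deriv (hd.1 i)).
- by rewrite (frac_der_tofrac hu) mderivC rmorph0.
rewrite /gen_c; have [k0|k_neq0] := eqVneq (val k) 0%N.
  rewrite (der1 hdelta) (_ : (k == j) = false) ?mul0r //.
  by apply: contraNF j_neq0 => /eqP <-; rewrite k0.
rewrite (der_sum hdelta).
under eq_bigr do rewrite hdelta.2 delta_xpow mulr0 addr0 delta_u.
rewrite (bigD1 g) //= eqxx andbT big1 ?addr0 // => h /negPf ->.
by rewrite andbF mul0r.
Qed.

End GenericExtension.

Unset Implicit Arguments.

Theorem theorem3p3 (F : fieldType) (m n : nat) (d : 'I_m -> F -> F)
  (hF : is_diff_field d) (hchar : [pchar F] =i pred0)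
  (hn : (0 < n)%N)
  (Sigma : ldp F m n -> Prop) (hlin : forall f, Sigma f -> is_linear_dp f)
  (e : 'I_n -> nat)
  (hord : forall f, Sigma f -> forall j, (op_ord (f.1 j) <= e j)%N)
  (ham : kolchin_am_zero d Sigma) :
  exists (G : fieldType) (dG : 'I_m -> G -> G) (iota : {rmorphism F -> G}),
    is_diff_ext d dG iota /\
    exists c : 'I_n -> G,
      (forall j : 'I_n, val j = 0%N -> c j = 1) /\
      (* M/N (scalars extended to G) equals tilde D psi, psi = sum_j c_j m_j *)
      (forall v : 'I_n -> diffop G m, exists lam : diffop G m,
          in_gen dG (lift_sys iota Sigma)
            (fun k => v k - opmul dG lam (c k)%:MP)) /\
      (* lam_j psi = m_j in M/N with ord lam_j <= 2^m (e_1 + ... + e_n) *)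
      (exists lam : 'I_n -> diffop G m, forall j : 'I_n,
          in_gen dG (lift_sys iota Sigma)
            (fun k => opmul dG (lam j) (c k)%:MP - (k == j)%:R) /\
          (op_ord (lam j) <= 2 ^ m * \sum_(i < n) e i)%N).
Proof.
(* The [f i] come from [Sigma] itself and not merely from [N], so the order bounds [e j] hold for
   them. *)
have [f Sf indep_f] := exists_dindep hF (kolchin_torsion ham).
(* The same [t] bounds the order of the relation and the degree of the [c_j] in the [x_i]. *)
pose t := (2 ^ m * \sum_(i < n) e i)%N.
pose G := gen_field F m n t; pose dG : 'I_m -> G -> G := gen_der d (n := n) (t := t).
pose iota : {rmorphism F -> G} := gen_iota F m n t.
have hext : is_diff_ext d dG iota := gen_ext hF n t.
pose fG i j : diffop G m := map_mpoly iota (f i j).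
have SfG i : lift_sys iota Sigma (fG i).
  by have [g [Sg fg]] := Sf i; exists g; rewrite /fG fg.
have indep_fG : dindep dG fG := dindep_lift hF hext indep_f.
have ord_fG i j : (op_ord (fG i j) <= e j)%N.
  have [g [Sg fg]] := Sf i; have := hord g Sg j; rewrite -fg !op_ord_msize.
  move=> le_f; apply/msize_leP => a le_a.
  by rewrite mcoeff_map_mpoly ((msize_leP _ _).2 le_f) //; apply: raddf0.
have c0 (j : 'I_n) : val j = 0%N -> gen_c F m t j = 1 by rewrite /gen_c => ->.
have generic (j : 'I_n) (g : 'X_{1..m}) : val j != 0%N -> (mdeg g <= t)%N ->
    exists delta : G -> G, [/\ derivation delta,
      forall i y, delta (dG i y) = dG i (delta y),
      forall i k, map_mpoly delta (fG i k) = 0 &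
      forall k, delta (gen_c F m t k) = (k == j)%:R * mmap1 (gen_x F n t) g].
  move=> j_neq0 le_g; have lt_g : (mdeg g < t.+1)%N by [].
  have [delta [hdelta delta_d delta_iota delta_c]] :=
    gen_delta hF (BMultinom lt_g) j_neq0.
  exists delta; split=> // i k; apply/mpolyP => a.
  by rewrite (mcoeff_map_der hdelta) mcoeff_map_mpoly mcoeff0; apply: delta_iota.
have charG := gen_char0 m n t hchar.
have dx := gen_dx hF n t.
exists G, dG, iota; split=> //; exists (gen_c F m t); split=> //; split.
  move=> v; exact: (generator_span hext.1 charG dx SfG indep_fG ord_fG generic c0).
have /fin_all_exists[lam lamP] j : exists lam, in_gen dG (lift_sys iota Sigma)
      (fun k => opmul dG lam (gen_c F m t k)%:MP - (k == j)%:R) /\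
    (op_ord lam <= t)%N.
  have [lam le_lam lamP] :=
    generator_bound hext.1 charG dx SfG indep_fG ord_fG generic c0 j.
  by exists lam.
by exists lam.
Qed.
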